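(* Let $E$ be a sharply dominating atomic Archimedean lattice effect algebra. The triple $(\mathrm{S}(E),\mathrm{M}(E),h)$ characterizes $E$ up to isomorphism. That is: if $E$ and $F$ are sharply dominating atomic Archimedean lattice effect algebras with associated maps $h_E:\mathrm{S}(E)\to 2^{\mathrm{M}(E)}$ and $h_F:\mathrm{S}(F)\to 2^{\mathrm{M}(F)}$, and there are an isomorphism of effect algebras $\alpha:\mathrm{S}(E)\to\mathrm{S}(F)$ and an isomorphism of generalized effect algebras $\beta:\mathrm{M}(E)\to\mathrm{M}(F)$ such that $\beta(h_E(s))=h_F(\alpha(s))$ for all $s\in\mathrm{S}(E)$, then $E$ and $F$ are isomorphic effect algebras.
   Context: An effect algebra is a partial algebra $(E;\oplus,0,1)$ with $0\ne 1$ and a partially defined binary operation $\oplus$ such that for all $x,y,z\in E$: (Ei) $x\oplus y=y\oplus x$ if $x\oplus y$ is defined; (Eii) $(x\oplus y)\oplus z=x\oplus(y\oplus z)$ if one side is defined; (Eiii) for every $x$ there is a unique $y$ with $x\oplus y=1$ (write $x'=y$); (Eiv) if $1\oplus x$ is defined then $x=0$. Put $x\le y$ and $y\ominus x=z$ iff $x\oplus z$ is defined and equals $y$; $\le$ is a partial order. $E$ is a lattice effect algebra if $(E,\le)$ is a lattice. For $x\in E$, $\mathrm{ord}(x)$ is the greatest positive integer $n$ for which $nx=x\oplus\cdots\oplus x$ ($n$ times) exists, and $\infty$ if all $nx$ exist; $E$ is Archimedean if $\mathrm{ord}(x)<\infty$ for all nonzero $x\in E$. An atom is a minimal nonzero element;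 $E$ is atomic if below every nonzero element there is an atom. Sharp elements: $\mathrm{S}(E)=\{x\in E\mid x\wedge x'=0\}$. $E$ is sharply dominating if for every $x\in E$ there is a smallest sharp element $\widehat{x}\in\mathrm{S}(E)$ with $x\le\widehat{x}$. For such (lattice) $E$, $\mathrm{S}(E)$ is a sub-lattice effect algebra of $E$, so an effect algebra with the inherited operation. Meager elements: $\mathrm{M}(E)=\{x\in E\mid \text{if }v\in\mathrm{S}(E)\text{ and }v\le x\text{ then }v=0\}$. On $\mathrm{M}(E)$ the partial operation $\oplus_{\mathrm{M}(E)}$ is defined by: $x\oplus_{\mathrm{M}(E)}y$ exists iff $x\oplus_E y$ exists and $x\oplus_E y\in\mathrm{M}(E)$, in which case $x\oplus_{\mathrm{M}(E)}y=x\oplus_E y$; this makes $\mathrm{M}(E)$ a generalized effect algebra. The map $h=h_E:\mathrm{S}(E)\to 2^{\mathrm{M}(E)}$ is $h(s)=\{x\in\mathrm{M}(E)\mid x\le s\}$. An isomorphism of effect algebras (resp. generalized effect algebras) is a bijection $f$ preserving $0$ and $1$ (resp. $0$) such that $x\oplus y$ is defined iff $f(x)\oplus f(y)$ is defined, in which case $f(x\oplus y)=f(x)\oplus f(y)$. *)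

(* Defs.v *)
From HB Require Import structures.
From mathcomp Require Import all_boot.
From mathcomp Require Import boolp classical_sets.

Set Implicit Arguments.
Unset Strict Implicit.
Unset Printing Implicit Defensive.

Local Open Scope classical_set_scope.

(* Partial operations take values in [option], with [None] for "undefined".
   The structures without axioms carry just the data that isomorphisms of
   generalized effect algebras, resp. of effect algebras, refer to. *)

HB.mixin Record hasPartialSum (T : Type) := {
  oplus : T -> T -> option T;
  ozero : T
}.

#[short(type="partialSumType")]
HB.structure Definition PartialSum := { T of hasPartialSum T }.

HB.mixin Record hasUnit (T : Type) of PartialSum T := {
  oone : T
}.

#[short(type="partialSumUnitType")]
HB.structure Definition PartialSumUnit :=
  { T of PartialSum T & hasUnit T }.

Arguments ozero {_}.
Arguments oone {_}.

(* As equalities in [option], [oplusC] and [oplusA] say that one side is defined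
   iff the other one is, with the same value. *)
HB.mixin Record isEffectAlgebra (T : Type) of PartialSumUnit T := {
  ozero_neq_oone : (ozero : T) <> oone;
  oplusC : forall x y : T, oplus x y = oplus y x;
  oplusA : forall x y z : T,
    obind (fun u => oplus u z) (oplus x y) =
    obind (fun v => oplus x v) (oplus y z);
  osupp_uniq : forall x : T, exists! y : T, oplus x y = Some oone;
  oplus1_eq0 : forall x : T, isSome (oplus oone x) -> x = ozero
}.

#[short(type="effectAlgebra")]
HB.structure Definition EffectAlgebra :=
  { T of PartialSumUnit T & isEffectAlgebra T }.

(* Isomorphisms.  The equation says that [oplus x y] is defined iff
   [oplus (f x) (f y)] is, in which case [f] maps the former to the latter. *)

Definition gen_effect_iso (T U : partialSumType) (f : T -> U) : Prop :=
  [/\ bijective f, f ozero = ozero &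
      forall x y : T, oplus (f x) (f y) = omap f (oplus x y)].

Definition effect_iso (T U : partialSumUnitType) (f : T -> U) : Prop :=
  gen_effect_iso f /\ f oone = oone.

Section EffectAlgebraNotions.
Variable E : effectAlgebra.
Implicit Types (x y z m s v a : E) (n k : nat).

Definition osupp x : E := sval (cid (osupp_uniq x)).

Definition ole x y : Prop := exists z, oplus x z = Some y.

Definition is_meet x y m : Prop :=
  [/\ ole m x, ole m y & forall v, ole v x -> ole v y -> ole v m].

Definition is_join x y m : Prop :=
  [/\ ole x m, ole y m & forall v, ole x v -> ole y v -> ole m v].

Definition lattice_ordered : Prop :=
  forall x y, (exists m, is_meet x y m) /\ (exists m, is_join x y m).

Fixpoint nsum n x : option E :=
  if n is k.+1 then obind (fun u => oplus u x) (nsum k x) else Some ozero.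

(* [has_ord x n] is "ord(x) = n" for finite n; "ord(x) is infinite" is the
   absence of such an n. *)
Definition has_ord x n : Prop :=
  [/\ 0 < n, isSome (nsum n x) &
      forall k, 0 < k -> isSome (nsum k x) -> k <= n].

Definition archimedean : Prop :=
  forall x, x <> ozero -> exists n, has_ord x n.

Definition atom a : Prop :=
  a <> ozero /\ forall y, y <> ozero -> ole y a -> y = a.

Definition atomic : Prop :=
  forall x, x <> ozero -> exists a, atom a /\ ole a x.

Definition sharp : set E := [set x | is_meet x (osupp x) ozero].

Definition meager : set E :=
  [set x | forall v, sharp v -> ole v x -> v = ozero].

Definition sharply_dominating : Prop :=
  forall x, exists s,
    [/\ sharp s, ole x s & forall t : E, sharp t -> ole x t -> ole s t].

(* The operation of E restricted to A: defined iff the sum exists in E and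
   belongs to A.  In a lattice effect algebra the sharp elements are closed
   under sums, so for A = S(E) the second condition is automatic. *)
Definition sub_oplus (A : set E) (x y : A) : option A :=
  obind insub (oplus (val x) (val y)).

Lemma sub_oplusP (A : set E) (x y z : A) :
  sub_oplus x y = Some z <-> oplus (val x) (val y) = Some (val z).
Proof.
rewrite /sub_oplus; case: (oplus (val x)) => //= u.
case: insubP => [w _ <-|nAu]; first by split=> [[->]|[/val_inj ->]].
by split=> // -[e]; case/negP: nAu; rewrite e; apply: valP z.
Qed.

Lemma osuppP x : oplus x (osupp x) = Some oone.
Proof. by rewrite /osupp; case: cid => y []. Qed.

Lemma osupp_unique x y : oplus x y = Some oone -> y = osupp x.
Proof.
by rewrite /osupp; case: cid => z /= [_ zP] xy; rewrite (zP y xy).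
Qed.

Lemma oone_oplus0 : oplus oone ozero = Some (oone : E).
Proof.
have h := osuppP oone; rewrite -[X in oplus _ X](_ : osupp oone = _) //.
by apply: oplus1_eq0; rewrite h.
Qed.

Lemma oplus0 x : oplus x ozero = Some x.
Proof.
have := oplusA (osupp x) x ozero.
rewrite oplusC osuppP /= oone_oplus0; case: (oplus x ozero) => //= u e.
have -> : u = osupp (osupp x) by apply: osupp_unique.
by congr Some; apply/esym/osupp_unique; rewrite oplusC osuppP.
Qed.

Lemma ole0x x : ole ozero x.
Proof. by exists x; rewrite oplusC oplus0. Qed.

Lemma olexx x : ole x x.
Proof. by exists ozero; rewrite oplus0. Qed.

Lemma ole_x0 x : ole x ozero -> x = ozero.
Proof.
case=> z xz; apply: oplus1_eq0.
have := oplusA z x oone; rewrite oplusC xz /= oplusC oone_oplus0.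
by rewrite [oplus oone x]oplusC; case: (oplus x oone).
Qed.

Lemma sharp0 : sharp ozero.
Proof. by split=> //; apply: ole0x. Qed.

Lemma sharp1 : sharp oone.
Proof.
rewrite /sharp /= (_ : osupp oone = ozero).
  by split=> //; apply: ole0x.
by apply: oplus1_eq0; rewrite osuppP.
Qed.

Lemma meager0 : meager ozero.
Proof. by move=> v _; apply: ole_x0. Qed.

End EffectAlgebraNotions.

Arguments sharp : clear implicits.
Arguments meager : clear implicits.

Definition sharp_type (E : effectAlgebra) : Type := sharp E.
Definition meager_type (E : effectAlgebra) : Type := meager E.

HB.instance Definition _ (E : effectAlgebra) :=
  hasPartialSum.Build (sharp_type E)
    (@sub_oplus E (sharp E)) (SigSub (mem_set (@sharp0 E))).
HB.instance Definition _ (E : effectAlgebra) :=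
  hasUnit.Build (sharp_type E) (SigSub (mem_set (@sharp1 E))).

HB.instance Definition _ (E : effectAlgebra) :=
  hasPartialSum.Build (meager_type E)
    (@sub_oplus E (meager E)) (SigSub (mem_set (@meager0 E))).

Definition hmap (E : effectAlgebra) (s : sharp_type E) : set (meager_type E) :=
  [set x | ole (val x) (val s)].

(* Main.v *)
Require Import Defs.
From mathcomp Require Import all_boot.
From mathcomp Require Import boolp classical_sets.

Local Open Scope classical_set_scope.

Set Implicit Arguments.
Unset Strict Implicit.
Unset Printing Implicit Defensive.

(** The idea is that [x] in [E] is recovered from its greatest sharp minorant
    [s] and the meager remainder [m], where [x = s ⊕ m]: this decomposition is
    unique ([greatest_sharp_below], [sharp_meager_uniq]), and the candidate
    isomorphism sends [s ⊕ m] to [alpha s ⊕ beta m].  That sum exists, because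
    [s ⊕ m] is defined iff [m] lies in [h (osupp s)].  The same recipe for the
    inverses of [alpha] and [beta] gives the inverse map, so only one direction
    of additivity needs proof: if [x ⊕ y = z] in [E] then the images add up to
    the image of [z].

    A sum of two sharp elements is sharp, so additivity is a question about
    sums [m ⊕ n] of meager elements.  Such a sum, [s ⊕ k] with [s] sharp and
    [k] meager, splits ([split_sum]): [m = m1 ⊕ m2] and [n = n1 ⊕ n2] with
    [m1 ⊕ n1 = s] and [m2 ⊕ n2 = k].  The second sum stays among the meager
    elements and is respected by [beta].  What has to be seen is that the triple
    also determines the sums [x ⊕ y = s] of two meager elements that are sharp
    ([sharp_sum_transport]).

    In [F], [beta x] has some meager complement [beta w] in [alpha s]
    ([meager_sum_transport]), and the claim is [w = y].  This is checked on
    atoms.  An atom [a] of finite order [n] has [n a] sharp and [j a] meager for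
    [j < n], so [beta] preserves orders of meager atoms.  If [a] lies below [x]
    with multiplicity [k], then [a] has multiplicity exactly [n - k] in the
    complement of [x] ([mult_complement]), whether it is taken in [E] or in [F];
    hence [w] and [y] have the same atoms with the same multiplicities, and these
    multiplicities determine the order ([ole_mult]).

    All lattice arguments rest on one fact ([disjoint_sum_le]): if [u] and [v]
    have meet zero and [u ⊕ v] exists, then [u ⊕ v] is their join. *)

(** * Sums and order in an effect algebra *)

(** Absorbing undefinedness turns the partial operation into a total commutative
    monoid on [option E], in which sums can be rearranged freely; a sum that
    is [Some z] has all its partial sums defined. *)

Definition osum (E : effectAlgebra) (p q : option E) : option E :=
  obind (fun x => obind (oplus x) q) p.

Local Notation "p ⊕ q" := (osum p q) (at level 50, left associativity).

Definition orth (E : effectAlgebra) (x y : E) : Prop :=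
  exists z, Some x ⊕ Some y = Some z.

Definition disjoint (E : effectAlgebra) (x y : E) : Prop :=
  forall v, ole v x -> ole v y -> v = ozero.

Section Sums.
Variable E : effectAlgebra.
Implicit Types (x y z u v w s t m a d : E) (p q r : option E).

Lemma oplusE x y : oplus x y = Some x ⊕ Some y.
Proof. by []. Qed.

Lemma osumC : commutative (@osum E).
Proof. by case=> [x|] [y|] //=; apply: oplusC. Qed.

Lemma osumA : associative (@osum E).
Proof.
case=> [x|] [y|] [z|] //=; last by case: (oplus x y).
have := oplusA x y z; rewrite /osum /=.
by case: (oplus x y) => [u|] /=; case: (oplus y z) => [v|].
Qed.

Lemma osum0 : left_id (Some ozero) (@osum E).
Proof. by case=> //= x; rewrite oplusC oplus0. Qed.

Lemma osumACA : interchange (@osum E) (@osum E).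
Proof. by move=> p q r p'; rewrite -!osumA (osumA q) (osumC q) !osumA. Qed.

Lemma osum_defl p q z : p ⊕ q = Some z -> exists x, p = Some x.
Proof. by case: p => // x _; exists x. Qed.

Lemma osum_defr p q z : p ⊕ q = Some z -> exists x, q = Some x.
Proof. by rewrite osumC; apply: osum_defl. Qed.

(** Cancellation: if [x ⊕ v = z] then [v] is the supplement of
    [x ⊕ osupp z], which does not involve [v]. *)
Lemma osumI p q r z : p ⊕ q = Some z -> p ⊕ r = Some z -> q = r.
Proof.
case: p => // x; case: q => // y; case: r => [y'|]; rewrite /= => // xy xy'.
have h v : oplus x v = Some z ->
    Some v ⊕ (Some x ⊕ Some (osupp z)) = Some oone.
  by move=> e; rewrite osumA [Some v ⊕ _]osumC /= e /= osuppP.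
move: (h _ xy) (h _ xy') => /[dup] /osum_defr [c ->] /= e e'.
rewrite oplusC in e; rewrite oplusC in e'.
by rewrite (osupp_unique e) (osupp_unique e').
Qed.

Lemma oleP x y : ole x y <-> exists q, Some x ⊕ q = Some y.
Proof.
by split=> [[z xz]|[[z|] //= xz]]; [exists (Some z) | exists z].
Qed.

Lemma ole_osum x y p : Some x ⊕ p = Some y -> ole x y.
Proof. by move=> e; apply/oleP; exists p. Qed.

Lemma ole_trans x y z : ole x y -> ole y z -> ole x z.
Proof.
move=> /oleP[q xq] /oleP[r yr]; apply/oleP; exists (q ⊕ r).
by rewrite osumA xq.
Qed.

Lemma ole_anti x y : ole x y -> ole y x -> x = y.
Proof.
move=> [q xq] /oleP[r yr].
have e : Some x ⊕ (Some q ⊕ r) = Some x by rewrite osumA /= xq.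
have qr : Some q ⊕ r = Some ozero by apply: osumI e _; apply: oplus0.
by move: xq; rewrite (@ole_x0 _ q) ?oplus0; [case | apply: ole_osum qr].
Qed.

Lemma orthC x y : orth x y -> orth y x.
Proof. by case=> z e; exists z; rewrite osumC. Qed.

Lemma orth_osum x y p z : Some x ⊕ Some y ⊕ p = Some z -> orth x y.
Proof. by move=> /osum_defl[u]; exists u. Qed.

Lemma orthS x y u : ole x y -> orth y u -> orth x u.
Proof.
move=> /oleP[q xq] [z].
by rewrite -xq [_ ⊕ q]osumC -osumA => /osum_defr.
Qed.

Lemma osuppK x : osupp (osupp x) = x.
Proof. by apply/esym/osupp_unique; rewrite oplusC osuppP. Qed.

Lemma orthP x y : orth x y <-> ole x (osupp y).
Proof.
split=> [[z xy]|[q xq]].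
  have e : Some y ⊕ (Some x ⊕ Some (osupp z)) = Some oone.
    by rewrite osumA [Some y ⊕ _]osumC xy /= osuppP.
  have [v xv] := osum_defr e; rewrite xv in e.
  by apply/oleP; exists (Some (osupp z)); rewrite xv (osupp_unique e).
apply: orthC; apply: (@orth_osum _ _ (Some q) oone).
by rewrite -osumA [Some x ⊕ _]xq; apply: osuppP.
Qed.

Lemma ole_add2l x p q y z :
  Some x ⊕ p = Some y -> Some x ⊕ q = Some z -> ole y z ->
  exists r, p ⊕ r = q.
Proof.
move=> xp xq /oleP[r yr]; exists r; apply: (osumI (p := Some x) (z := z)) => //.
by rewrite osumA xp.
Qed.

Lemma ole_cancel x y y' u w :
  Some x ⊕ Some y = Some u -> Some x ⊕ Some y' = Some w -> ole u w ->
  ole y y'.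
Proof.
by move=> xy xy' uw; have [r] := ole_add2l xy xy' uw; apply: ole_osum.
Qed.

Lemma ole_add x y y' w : ole y y' -> Some x ⊕ Some y' = Some w ->
  exists2 u, Some x ⊕ Some y = Some u & ole u w.
Proof.
move=> /oleP[q <-]; rewrite osumA => e; have [u xy] := osum_defl e.
by exists u => //; rewrite xy in e; apply: ole_osum e.
Qed.

Lemma ole_osumr x y p : p ⊕ Some x = Some y -> ole x y.
Proof. by rewrite osumC; apply: ole_osum. Qed.

Lemma ole_sum_idl x y z : Some x ⊕ Some y = Some z -> ole z x -> y = ozero.
Proof.
move=> xy /oleP[r zr]; apply: ole_x0; apply/oleP; exists r.
apply: (@osumI (Some x) _ _ x); last exact: oplus0.
by rewrite osumA xy.
Qed.

Lemma nsumS k x : nsum k.+1 x = nsum k x ⊕ Some x.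
Proof. by []. Qed.

Lemma nsumD j k x : nsum (j + k) x = nsum j x ⊕ nsum k x.
Proof.
elim: k => [|k IHk]; first by rewrite addn0 osumC osum0.
by rewrite addnS !nsumS IHk osumA.
Qed.

Lemma disjointC x y : disjoint x y -> disjoint y x.
Proof. by move=> d v vy vx; apply: d. Qed.

Lemma disjointS x y u : ole x y -> disjoint y u -> disjoint x u.
Proof. by move=> xy d v vx vu; apply: d (ole_trans vx xy) vu. Qed.

Lemma atom_disjoint a x : atom a -> ~ ole a x -> disjoint a x.
Proof.
move=> [_ a_min] nax v va vx; apply: contrapT => v0.
by apply: nax; rewrite -(a_min v v0 va).
Qed.

Lemma sharpP s : sharp E s <-> forall v, ole v s -> orth v s -> v = ozero.
Proof.
split=> [[_ _ h] v vs /orthP vs'|h]; first exact/ole_x0/h.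
split=> [||v vs vs']; [exact: ole0x | exact: ole0x |].
by rewrite (h v vs) ?orthP //; apply: ole0x.
Qed.

Lemma sharp_osupp s : sharp E s -> sharp E (osupp s).
Proof.
move=> /sharpP h; apply/sharpP => v vs' /orthP; rewrite osuppK => vs.
by apply: h; rewrite ?orthP.
Qed.

Lemma meager_le x y : meager E y -> ole x y -> meager E x.
Proof. by move=> h xy v vS vx; apply: h vS (ole_trans vx xy). Qed.

Lemma sharp_meager_eq0 s : sharp E s -> meager E s -> s = ozero.
Proof. by move=> sS sM; apply: sM sS (olexx s). Qed.

End Sums.

Section Lattice.
Variable E : effectAlgebra.
Hypothesis E_lattice : lattice_ordered E.
Implicit Types (x y z u v w s t m a d : E) (p q r : option E).

(** Orthogonal elements with meet zero have their sum as join: the excess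
    [d] of [u ⊕ v] over the join is below both [u] and [v]. *)
Lemma disjoint_sum_le u v z w : disjoint u v -> Some u ⊕ Some v = Some z ->
  ole u w -> ole v w -> ole z w.
Proof.
move=> uv uvz uw vw; have [_ [j [uj vj j_min]]] := E_lattice u v.
have uz := ole_osum uvz; have vz : ole v z.
  by apply: (@ole_osum _ v z (Some u)); rewrite osumC.
have [d jd] : ole j z by apply: j_min.
suff d0 : d = ozero.
  by move: jd; rewrite d0 oplus0 => -[<-]; apply: j_min.
have below x y : Some x ⊕ Some y = Some z -> ole x j -> ole d y.
  move=> xyz /oleP[q xq]; apply/oleP; exists q.
  apply: (@osumI _ (Some x) _ _ z) => //.
  by rewrite [Some d ⊕ _]osumC osumA xq.
by apply: uv; [apply: (below v) => //; rewrite osumC | apply: (below u)].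
Qed.

(** Pairwise orthogonality does not give a triple sum in general; here [v ⊕ w]
    is the join of [v] and [w], so it stays below the supplement of [u]. *)
Lemma orth3 u v w : orth u v -> orth u w -> orth v w -> disjoint v w ->
  exists z, Some u ⊕ Some v ⊕ Some w = Some z.
Proof.
move=> uv uw [e vwe] vw; rewrite -osumA vwe; apply/orthC/orthP.
by apply: disjoint_sum_le vw vwe _ _; apply/orthP/orthC.
Qed.

(** A common minorant [y] of [u ⊕ v] and [x] is orthogonal to and disjoint from
    [u], so [u ⊕ y] is a join below [u ⊕ v], whence [y] is below [v]. *)
Lemma disjoint_sum u v w x : disjoint u x -> disjoint v x -> orth u x ->
  Some u ⊕ Some v = Some w -> disjoint w x.
Proof.
move=> ux vx oux uvw y yw yx; apply: vx => //.
have /orthC [z uyz] : orth y u by apply: orthS yx (orthC oux).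
have zw : ole z w.
  apply: disjoint_sum_le uyz (ole_osum uvw) yw.
  by apply/disjointC/(disjointS yx)/disjointC.
have [r yr] := ole_add2l uyz uvw zw.
by apply: ole_osum yr.
Qed.

Lemma nsum_disjoint_orth a x j u : disjoint a x -> orth a x ->
  nsum j a = Some u -> disjoint u x /\ orth u x.
Proof.
move=> dax oax; elim: j u => [|j IHj] u.
  move=> [<-]; split; last by exists x; rewrite osum0.
  by move=> v /ole_x0.
rewrite nsumS => ju; have [v jv] := osum_defl ju.
rewrite jv in ju; have [dvx ovx] := IHj _ jv.
split; first exact: disjoint_sum ju.
have [||//|//|z] := @orth3 v a x; rewrite ?ju //; last by exists z.
by exists u.
Qed.

(** Sharp elements are principal: [u], [v] and [osupp s] are pairwise orthogonal
    and the last two are disjoint, so [u ⊕ v] is orthogonal to [osupp s]. *)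
Lemma sharp_principal s u v w : sharp E s -> ole u s -> ole v s ->
  Some u ⊕ Some v = Some w -> ole w s.
Proof.
move=> /sharpP sS us vs uvw; rewrite -[s]osuppK; apply/orthP.
have [||||z] := @orth3 u v (osupp s); rewrite ?uvw; try by exists z.
- by exists w.
- by apply/orthP; rewrite osuppK.
- by apply/orthP; rewrite osuppK.
- by move=> y yv /orthP; apply: sS; apply: ole_trans vs.
Qed.

Lemma sharp_sum s t u : sharp E s -> sharp E t ->
  Some s ⊕ Some t = Some u -> sharp E u.
Proof.
move=> /sharpP sS /sharpP tS stu; apply/sharpP => v vu ovu.
have su := ole_osum stu; have tu : ole t u.
  by apply: (@ole_osum _ t u (Some s)); rewrite osumC.
have ovs : orth s v by apply: orthS su (orthC ovu).
have dsv : disjoint s v.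
  by move=> y ys yv; apply: sS => //; apply: orthS yv (orthC ovs).
have [z svz] := ovs.
have [r vr] := ole_add2l svz stu (disjoint_sum_le dsv svz su vu).
apply: tS; first exact: ole_osum vr.
by apply/orthC; apply: orthS tu (orthC ovu).
Qed.

(** The difference [d] is the supplement of the sharp sum [osupp t ⊕ s]. *)
Lemma sharp_diff s d t : sharp E s -> sharp E t ->
  Some s ⊕ Some d = Some t -> sharp E d.
Proof.
move=> sS tS sdt.
have e : (Some (osupp t) ⊕ Some s) ⊕ Some d = Some oone.
  by rewrite -osumA sdt osumC; apply: osuppP.
have [u tsu] := osum_defl e; rewrite tsu in e.
rewrite (osupp_unique e); apply: sharp_osupp.
exact: sharp_sum (sharp_osupp tS) sS tsu.
Qed.

(** * Splitting along the sharp part *)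

(** Removing from [x] its meet [r] with [m] leaves [y], and the join [c] of [y]
    and [s] is [s ⊕ n] with [n ⊕ r] below [m].  Then [y] is disjoint from both
    [s] and [n], which forces [c] to be sharp.  So [n = c ⊖ s] is sharp as well
    as meager, hence zero, and [y] is below [s], hence zero. *)
Lemma disjoint_sharp_part s m x z : sharp E s -> meager E m ->
  Some s ⊕ Some m = Some z -> ole x z -> disjoint x s -> ole x m.
Proof.
move=> sS mM smz xz dxs.
have [[r [rx rm r_max]] _] := E_lattice x m.
have [y rxy] := rx.
have yx : ole y x by apply: (@ole_osum _ y x (Some r)); rewrite osumC.
have [_ [c [yc sc c_min]]] := E_lattice y s.
have [n snc] := sc.
have [w rw] : ole r z by apply: ole_trans rm _; apply: ole_osumr smz.
have ryx : Some r ⊕ Some y = Some x by [].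
(* [w] is the difference of [z] and [r]; it bounds [y] and [s], so that
   [c ⊕ r] exists and stays below [z] *)
have cw : ole c w.
  apply: c_min; first exact: ole_cancel ryx rw xz.
  have [u sru uz] := ole_add rm smz.
  by apply: ole_cancel rw uz; rewrite osumC.
have [e cre ez] := ole_add cw rw.
have [q nrq] : exists q, (Some n ⊕ Some r) ⊕ q = Some m.
  apply: (@ole_add2l _ s _ _ e z) => //.
  by rewrite osumA [_ ⊕ Some n]snc osumC.
have dny : disjoint n y.
  move=> v vn vy; have [u rvu ux] := ole_add vy ryx.
  apply: (ole_sum_idl rvu); apply: r_max => //.
  have [k rnk] := osum_defl nrq; rewrite rnk in nrq; rewrite osumC in rnk.
  have [u' rvu' uk] := ole_add vn rnk.
  by move: rvu'; rewrite rvu => -[->]; apply: ole_trans uk (ole_osum nrq).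
have cS : sharp E c.
  apply/sharpP => v vc ovc.
  have ovs : orth s v by apply: orthS sc (orthC ovc).
  have ovy : orth y v by apply: orthS yc (orthC ovc).
  have dvs : disjoint s v.
    by move=> k ks kv; move/sharpP: sS; apply=> //; apply: orthS kv (orthC ovs).
  have [u svu] := ovs; have uc := disjoint_sum_le dvs svu sc vc.
  have dvy : disjoint y v.
    by apply/disjointC/(disjointS _ dny); apply: ole_cancel svu snc uc.
  have [u' yvu] := ovy; have uc' := disjoint_sum_le dvy yvu yc vc.
  (* [y ⊕ v] and [s ⊕ v] are joins below [c], so [y] and [s] are below the
     difference [k] of [c] and [v]; hence so is [c], and [v] is zero *)
  have [k vkc] := vc; rewrite osumC in svu; rewrite osumC in yvu.
  have ck : ole c k.
    apply: c_min; first exact: ole_cancel yvu vkc uc'.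
    exact: ole_cancel svu vkc uc.
  by rewrite oplusC in vkc; apply: (ole_sum_idl vkc).
have nS : sharp E n by apply: sharp_diff sS cS snc.
have n0 : n = ozero.
  by apply: mM nS _; apply: (@ole_osum _ n m (Some r ⊕ q)); rewrite osumA.
move: snc; rewrite n0 oplus0 => -[sc'].
have y0 : y = ozero by apply: dxs yx _; rewrite sc'.
by move: rxy; rewrite y0 oplus0 => -[<-].
Qed.

(** [x1] is the meet of [x] and [s]; the rest is disjoint from [s] because
    [s] is principal. *)
Lemma split_below s m x z : sharp E s -> meager E m ->
  Some s ⊕ Some m = Some z -> ole x z ->
  exists x1 x2, [/\ Some x1 ⊕ Some x2 = Some x, ole x1 s & ole x2 m].
Proof.
move=> sS mM smz xz; have [[x1 [x1x x1s x1_max]] _] := E_lattice x s.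
have [x2 x12] := x1x; exists x1, x2; split=> //.
have x2x : ole x2 x by apply: (@ole_osumr _ x2 x (Some x1)).
apply: (disjoint_sharp_part sS mM smz (ole_trans x2x xz)) => v vx2 vs.
have [u x1v ux] := ole_add vx2 x12.
apply: (ole_sum_idl x1v); apply: x1_max => //.
exact: sharp_principal sS x1s vs x1v.
Qed.

(** Splitting both summands along [s], the [s]-parts add up to [t] below [s] and
    the [m]-parts to an element of [osupp s].  Since the total is [s ⊕ m], the
    gap between [t] and [s] lies below both [s] and [osupp s], so it is zero. *)
Lemma split_sum x y s m z : Some x ⊕ Some y = Some z ->
  sharp E s -> meager E m -> Some s ⊕ Some m = Some z ->
  exists x1 x2 y1 y2,
    [/\ Some x1 ⊕ Some x2 = Some x, Some y1 ⊕ Some y2 = Some y,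
        Some x1 ⊕ Some y1 = Some s & Some x2 ⊕ Some y2 = Some m].
Proof.
move=> xyz sS mM smz.
have [x1 [x2 [ex x1s x2m]]] := split_below sS mM smz (ole_osum xyz).
have [y1 [y2 [ey y1s y2m]]] := split_below sS mM smz (ole_osumr xyz).
have := xyz; rewrite -ex -ey osumACA => e.
have [t et] := osum_defl e; have [n en] := osum_defr e; rewrite et en in e.
have ms' : ole m (osupp s) by apply/orthP/orthC; exists z.
have [d td] : ole t s by apply: sharp_principal sS x1s y1s et.
have edm : Some d ⊕ Some m = Some n.
  apply: (@osumI _ (Some t) _ _ z) => //.
  by rewrite osumA [_ ⊕ Some d]td.
have ns' : ole n (osupp s).
  by apply: (sharp_principal (sharp_osupp sS) _ _ en); apply: ole_trans ms'.
have d0 : d = ozero.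
  move/sharpP: sS; apply; first exact: (@ole_osumr _ d s (Some t)).
  by apply/orthP; apply: ole_trans ns'; apply: ole_osum edm.
exists x1, x2, y1, y2; split=> //.
  by rewrite et -td d0 oplus0.
by rewrite en -edm d0 osum0.
Qed.

Section SharplyDominating.
Hypothesis E_sdom : sharply_dominating E.

(** The greatest sharp minorant of [x] is the supplement of the least sharp
    majorant of [osupp x]; the remainder is meager by maximality, sums of sharp
    elements being sharp. *)
Lemma greatest_sharp_below x : exists s m,
  [/\ sharp E s, meager E m, Some s ⊕ Some m = Some x &
      forall t, sharp E t -> ole t x -> ole t s].
Proof.
have [c [cS xc c_min]] := E_sdom (osupp x).
have gx t : sharp E t -> ole t x -> ole t (osupp c).
  move=> tS tx; apply/orthP/orthC/orthP; apply: c_min; first exact: sharp_osupp.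
  by apply/orthP/orthC/orthP; rewrite osuppK.
have [m cm] : ole (osupp c) x.
  by rewrite -[x]osuppK; apply/orthP/orthC/orthP; rewrite osuppK.
exists (osupp c), m; split=> //; first exact: sharp_osupp.
move=> v vS vm; have [u cv ux] := ole_add vm cm.
apply: (ole_sum_idl cv); apply: gx => //.
exact: sharp_sum (sharp_osupp cS) vS cv.
Qed.

Lemma sharp_meager_uniq s m t n x : sharp E s -> meager E m ->
  sharp E t -> meager E n ->
  Some s ⊕ Some m = Some x -> Some t ⊕ Some n = Some x -> s = t /\ m = n.
Proof.
move=> sS mM tS nM sm tn.
have [g [k [gS _ gk g_max]]] := greatest_sharp_below x.
have eg u w : sharp E u -> meager E w -> Some u ⊕ Some w = Some x -> u = g.
  move=> uS wM uw; have [d ud] := g_max _ uS (ole_osum uw).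
  have d0 : d = ozero.
    apply: wM; first exact: sharp_diff uS gS ud.
    exact: ole_cancel ud uw (ole_osum gk).
  by move: ud; rewrite d0 oplus0 => -[].
have st : s = t by rewrite (eg _ _ sS mM sm) (eg _ _ tS nM tn).
split=> //; rewrite st in sm.
by have [] : Some m = Some n by apply: osumI sm tn.
Qed.

End SharplyDominating.

(** * Multiplicities of atoms *)

(** [k] is the largest number with [k a] defined and below [x]. *)
Definition has_mult a x k : Prop :=
  (exists2 u, nsum k a = Some u & ole u x) /\
  (forall j u, nsum j a = Some u -> ole u x -> j <= k).

Lemma nsum_leq a n j : isSome (nsum n a) -> j <= n ->
  exists u, nsum j a = Some u.
Proof.
case e: (nsum n a) => [t|] // _ jn.
by apply: (@osum_defl _ _ (nsum (n - j) a) t); rewrite -nsumD subnKC.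
Qed.

Lemma nsum1 a : nsum 1 a = Some a.
Proof. by rewrite nsumS osum0. Qed.

Lemma ole_nsum a k u : 0 < k -> nsum k a = Some u -> ole a u.
Proof. by case: k => // k _; rewrite nsumS; apply: ole_osumr. Qed.

Lemma mult_ex a x n : has_ord a n -> exists2 k, has_mult a x k & k <= n.
Proof.
move=> [n0 na n_max].
pose P j := `[< exists2 u, nsum j a = Some u & ole u x >].
have P0 : exists j, P j.
  by exists 0; apply/asboolP; exists ozero; last exact: ole0x.
have P_le j : P j -> j <= n.
  move=> /asboolP[u ju _]; case: (posnP j) => [->|j0] //.
  by apply: n_max; rewrite ?ju.
case: (ex_maxnP P0 P_le) => k /[dup] /P_le kn /asboolP[u ku ux] k_max.
exists k => //; split; first by exists u.
by move=> j v jv vx; apply: k_max; apply/asboolP; exists v.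
Qed.

(** An element below [s] is disjoint from and orthogonal to [osupp s], hence so
    are its multiples. *)
Lemma nsum_le_sharp a s j u : sharp E s -> ole a s ->
  nsum j a = Some u -> ole u s.
Proof.
move=> /sharpP sS as_ ju; rewrite -[s]osuppK; apply/orthP.
have oas : orth a (osupp s) by apply/orthP; rewrite osuppK.
have das : disjoint a (osupp s).
  by move=> v va /orthP; apply: sS; apply: ole_trans as_.
by have [] := nsum_disjoint_orth das oas ju.
Qed.

(** Let [v] be below [t = n a] and orthogonal to it.  If [a] is below [v], then
    [t ⊕ a] exists, against the maximality of [n]; otherwise [a] is disjoint
    from and orthogonal to [v], hence so is [t], and [v] is zero. *)
Lemma nsum_ord_sharp a n t : atom a -> has_ord a n -> nsum n a = Some t ->
  sharp E t.
Proof.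
move=> aA [n0 _ n_max] nt; apply/sharpP => v vt ovt.
have a_t := ole_nsum n0 nt.
have [av|nav] := pselect (ole a v).
  have [u uS] := orthC (orthS av ovt).
  by have := n_max n.+1 isT; rewrite nsumS nt uS ltnn => /(_ isT).
have dav := atom_disjoint aA nav.
have oav : orth a v by apply: orthS a_t (orthC ovt).
have [dtv _] := nsum_disjoint_orth dav oav nt.
exact: dtv vt (olexx v).
Qed.

(** A sharp [v] below [j a] is either above [a], hence above [(j + 1) a], which
    is too large, or disjoint from [a], hence from [j a]. *)
Lemma nsum_meager a n j u : atom a -> has_ord a n -> j < n ->
  nsum j a = Some u -> meager E u.
Proof.
move=> aA [_ na _] jn ju v vS vu.
have [w] := nsum_leq na jn; rewrite nsumS ju => ua.
have [av|nav] := pselect (ole a v).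
  have [t ut] := nsum_leq na jn.
  have tv := nsum_le_sharp vS av ut.
  case: aA => a0 _; case: a0; rewrite nsumS ju in ut.
  exact: ole_sum_idl ut (ole_trans tv vu).
have dav := atom_disjoint aA nav.
have oav : orth a v by apply/orthC; apply: orthS vu _; exists w.
have [duv _] := nsum_disjoint_orth dav oav ju.
exact: duv vu (olexx v).
Qed.

(** Write [x = k a ⊕ x2] with [a] not below [x2].  Then [n a] and [x2] are
    disjoint and orthogonal, and both are below [s], since [s] is sharp.  So
    [n a ⊕ x2] is below [s = k a ⊕ x2 ⊕ y], and cancellation puts [(n - k) a]
    below [y].  A larger multiple of [a] below [y] would exceed the order. *)
Lemma mult_complement x y s a n k : Some x ⊕ Some y = Some s -> sharp E s ->
  atom a -> has_ord a n -> ole a x -> has_mult a x k -> has_mult a y (n - k).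
Proof.
move=> xys sS aA an ax [[u ku ux] k_max].
have [n0 na n_max] := an.
have k0 : 0 < k by apply: k_max ax; apply: nsum1.
have kn : k <= n by apply: n_max; rewrite ?ku.
have au := ole_nsum k0 ku.
have [x2 ux2] := ux; rewrite -[oplus u x2]/(Some u ⊕ Some x2) in ux2.
have nax2 : ~ ole a x2.
  move=> ax2; have [w ua wx] := ole_add ax2 ux2.
  by have := k_max k.+1 w; rewrite nsumS ku ltnn => /(_ ua wx).
have dax2 := atom_disjoint aA nax2.
have oax2 : orth a x2 by apply: orthS au _; exists x.
have [t nt] := nsum_leq na (leqnn n).
have [dtx2 [w tx2]] := nsum_disjoint_orth dax2 oax2 nt.
have xs := ole_osum xys.
have ws : ole w s.
  apply: disjoint_sum_le dtx2 tx2 (nsum_le_sharp sS (ole_trans ax xs) nt) _.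
  by apply: ole_trans xs; apply: (@ole_osumr _ x2 x (Some u)).
have nkt := nt; rewrite -(subnKC kn) nsumD ku in nkt.
have [u' nku] := osum_defr nkt; rewrite nku in nkt.
split; first exists u' => //.
  apply: (@ole_cancel _ x u' y w s) => //.
  rewrite -ux2 -tx2 -nkt.
  by rewrite -!osumA [Some x2 ⊕ _]osumC.
move=> j v jv vy; have [r xv _] := ole_add vy xys.
have [q uv _] : exists2 q, Some v ⊕ Some u = Some q & ole q r.
  by apply: ole_add ux _; rewrite osumC.
rewrite leq_subRL //; apply: n_max; first by rewrite addn_gt0 k0.
by rewrite nsumD ku jv osumC uv.
Qed.

Lemma mult_lt x a n k : meager E x -> atom a -> has_ord a n ->
  has_mult a x k -> k < n.
Proof.
move=> xM aA an [[u ku ux] _]; have [n0 na n_max] := an.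
rewrite ltnNge; apply/negP => nk.
have [t nt] := nsum_leq na (leqnn n).
have /eqP: k == n.
  by rewrite eqn_leq nk andbT; apply: n_max; rewrite ?ku ?(leq_trans n0).
move=> e; move: ku; rewrite e nt => -[tu].
have t0 : t = ozero by apply: xM (nsum_ord_sharp aA an nt) _; rewrite tu.
by case: (proj1 aA); apply: ole_x0; rewrite -t0; apply: ole_nsum nt.
Qed.

(** If the meet [m] of [x] and [y] is not [x], take an atom [a] below [x ⊖ m] and
    its multiplicity [k] in [x]: then [k a] is below [m], and [(k + 1) a]
    is below [x]. *)
Lemma ole_mult x y : atomic E -> archimedean E ->
  (forall a k u, atom a -> ole a x -> has_mult a x k ->
     nsum k a = Some u -> ole u y) -> ole x y.
Proof.
move=> E_atomic E_arch h; have [[m [mx my m_max]] _] := E_lattice x y.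
have [d md] := mx; have [d0|/E_atomic[a [aA ad]]] := pselect (d = ozero).
  by move: md; rewrite d0 oplus0 => -[<-].
have ax : ole a x by apply: ole_trans ad (@ole_osumr _ d x (Some m) md).
have [n an] := E_arch a (proj1 aA).
have [k /[dup] xk [[u ku ux] k_max] _] := mult_ex x an.
have um : ole u m by apply: m_max ux _; apply: h xk ku.
have [w ma wx] := ole_add ad md; rewrite osumC in ma.
have [v au vw] := ole_add um ma; rewrite osumC in au.
by have := k_max k.+1 v; rewrite nsumS ku ltnn => /(_ au (ole_trans vw wx)).
Qed.

End Lattice.

(** * Transport along an isomorphism of triples *)

(** An isomorphism of triples with explicit inverses, expressed on the values in
    [E] and [F]; in this form it is visibly symmetric in [E] and [F]. *)
Record triple_iso (E F : effectAlgebra)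
    (alpha : sharp_type E -> sharp_type F)
    (alpha' : sharp_type F -> sharp_type E)
    (beta : meager_type E -> meager_type F)
    (beta' : meager_type F -> meager_type E) : Prop := TripleIso {
  alphaK : cancel alpha alpha';
  alphaK' : cancel alpha' alpha;
  betaK : cancel beta beta';
  betaK' : cancel beta' beta;
  alpha1 : alpha oone = oone;
  alpha_sum : forall s t u : sharp_type E,
    oplus (val s) (val t) = Some (val u) <->
    oplus (val (alpha s)) (val (alpha t)) = Some (val (alpha u));
  beta_sum : forall m n k : meager_type E,
    oplus (val m) (val n) = Some (val k) <->
    oplus (val (beta m)) (val (beta n)) = Some (val (beta k));
  beta_below : forall (m : meager_type E) (s : sharp_type E),
    ole (val m) (val s) <-> ole (val (beta m)) (val (alpha s))
}.

Lemma triple_iso_sym E F (alpha : sharp_type E -> sharp_type F) alpha'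
    (beta : meager_type E -> meager_type F) beta' :
  triple_iso alpha alpha' beta beta' -> triple_iso alpha' alpha beta' beta.
Proof.
move=> h; split; try by case: h.
- by rewrite -(alpha1 h) (alphaK h).
- by move=> s t u; rewrite (alpha_sum h) !(alphaK' h).
- by move=> m n k; rewrite (beta_sum h) !(betaK' h).
- by move=> m s; rewrite (beta_below h) (alphaK' h) (betaK' h).
Qed.

Lemma sharp_type_val (E : effectAlgebra) (s : sharp_type E) : sharp E (val s).
Proof. exact: set_mem (valP s). Qed.

Lemma meager_type_val (E : effectAlgebra) (m : meager_type E) :
  meager E (val m).
Proof. exact: set_mem (valP m). Qed.

Arguments sharp_type_val {E} s.
Arguments meager_type_val {E} m.

Lemma sharp_type_of (E : effectAlgebra) (s : E) :
  sharp E s -> exists s' : sharp_type E, s = val s'.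
Proof. by move=> sS; exists (SigSub (mem_set sS)). Qed.

Lemma meager_type_of (E : effectAlgebra) (m : E) :
  meager E m -> exists m' : meager_type E, m = val m'.
Proof. by move=> mM; exists (SigSub (mem_set mM)). Qed.

Section Transport.
Variables (E F : effectAlgebra).
Variables (alpha : sharp_type E -> sharp_type F)
          (alpha' : sharp_type F -> sharp_type E)
          (beta : meager_type E -> meager_type F)
          (beta' : meager_type F -> meager_type E).
Hypothesis iso : triple_iso alpha alpha' beta beta'.
Implicit Types (s t u : sharp_type E) (m n k a : meager_type E).

Lemma beta_le m n : ole (val m) (val n) -> ole (val (beta m)) (val (beta n)).
Proof.
move=> [d md].
have [k dk] : exists k : meager_type E, d = val k.
  apply: meager_type_of; apply: meager_le (meager_type_val n) _.
  exact: (@ole_osumr _ d (val n) (Some (val m))).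
by exists (val (beta k)); apply/(beta_sum iso); rewrite -dk.
Qed.

Lemma beta0 m : val m = ozero -> val (beta m) = ozero.
Proof.
move=> m0.
have : Some (val (beta m)) ⊕ Some (val (beta m)) = Some (val (beta m)).
  by apply/(beta_sum iso); rewrite m0 oplus0.
by move=> e; apply: ole_sum_idl e (olexx _).
Qed.

Lemma alpha0 s : val s = ozero -> val (alpha s) = ozero.
Proof.
move=> s0.
have : Some (val (alpha s)) ⊕ Some (val (alpha s)) = Some (val (alpha s)).
  by apply/(alpha_sum iso); rewrite s0 oplus0.
by move=> e; apply: ole_sum_idl e (olexx _).
Qed.

(** [s ⊕ m] is defined iff [m] is in [h (osupp s)], and [alpha] preserves
    supplements. *)
Lemma beta_orth s m : orth (val s) (val m) ->
  orth (val (alpha s)) (val (beta m)).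
Proof.
have [s' es'] := sharp_type_of (sharp_osupp (sharp_type_val s)).
move=> /orthC/orthP; rewrite es' => /(beta_below iso) h.
apply/orthC/orthP; apply: ole_trans h _.
suff -> : val (alpha s') = osupp (val (alpha s)) by apply: olexx.
apply: osupp_unique; have -> : oone = val (oone : sharp_type F) by [].
by rewrite -(alpha1 iso) -(alpha_sum iso) -es' osuppP.
Qed.

Lemma beta_nsum a m j : nsum j (val a) = Some (val m) ->
  nsum j (val (beta a)) = Some (val (beta m)).
Proof.
elim: j m => [|j IHj] m; first by move=> [/esym m0]; rewrite (beta0 m0).
rewrite !nsumS => e; have [u ju] := osum_defl e; rewrite ju in e.
have [k uk] : exists k : meager_type E, u = val k.
  by apply: meager_type_of; apply: meager_le (meager_type_val m) (ole_osum e).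
by rewrite uk in ju e; rewrite (IHj k) //; apply/(beta_sum iso).
Qed.

End Transport.

Section TransportAtoms.
Variables (E F : effectAlgebra).
Variables (alpha : sharp_type E -> sharp_type F)
          (alpha' : sharp_type F -> sharp_type E)
          (beta : meager_type E -> meager_type F)
          (beta' : meager_type F -> meager_type E).
Hypothesis iso : triple_iso alpha alpha' beta beta'.
Implicit Types (s t u : sharp_type E) (m n a x y : meager_type E).
Let iso' := triple_iso_sym iso.

Lemma beta_atom a : atom (val a) -> atom (val (beta a)).
Proof.
move=> [a0 a_min]; split=> [/(beta0 iso')|y y0 ya].
  by rewrite (betaK iso).
have [y' ey] := meager_type_of (meager_le (meager_type_val (beta a)) ya).
rewrite ey in ya y0 *; congr val; rewrite -[y'](betaK' iso); congr beta.
apply/val_inj/a_min.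
  by move=> /(beta0 iso); rewrite (betaK' iso).
by have := beta_le iso' ya; rewrite (betaK iso).
Qed.

Lemma beta_mult a x k : has_mult (val a) (val x) k ->
  has_mult (val (beta a)) (val (beta x)) k.
Proof.
move=> [[u ku ux] k_max]; split=> [|j v jv vx].
  have [u' eu] := meager_type_of (meager_le (meager_type_val x) ux).
  rewrite eu in ku ux; exists (val (beta u')); first exact: (beta_nsum iso).
  exact: (beta_le iso).
have [v' ev] := meager_type_of (meager_le (meager_type_val (beta x)) vx).
rewrite ev in jv vx; apply: (k_max _ (val (beta' v'))).
  by rewrite -(betaK iso a); apply: (beta_nsum iso').
by rewrite -(betaK iso x); apply: (beta_le iso').
Qed.

(** Otherwise [j a] is meager in [E], so its image is meager; but [j] is the
    order of the image of [a], so the image of [j a] is sharp too, hence zero. *)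
Lemma ord_le_beta (E_lattice : lattice_ordered E)
    (F_lattice : lattice_ordered F) a i j :
  atom (val a) -> has_ord (val a) i -> has_ord (val (beta a)) j -> i <= j.
Proof.
move=> aA ai aj; rewrite leqNgt; apply/negP => ji.
have [i0 na _] := ai; have [j0 _ _] := aj.
have [u ju] := nsum_leq na (ltnW ji).
have [m um] := meager_type_of (nsum_meager E_lattice aA ai ji ju).
rewrite um in ju; have bju := beta_nsum iso ju.
have bm0 : val (beta m) = ozero.
  exact: sharp_meager_eq0 (nsum_ord_sharp F_lattice (beta_atom aA) aj bju)
    (meager_type_val _).
have [b0 _] := beta_atom aA; apply/b0/ole_x0; rewrite -bm0.
exact: ole_nsum bju.
Qed.

(** The complement [c] of [beta x] in [alpha s] is meager.  For [v] sharp
    below [c], the difference of [alpha s] and [v] is sharp and above [beta x].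
    Pulling back along [alpha], the preimage of [v] is a sharp element below
    [y], which is meager. *)
Lemma meager_sum_transport s x y : lattice_ordered F ->
  oplus (val x) (val y) = Some (val s) ->
  exists w, oplus (val (beta x)) (val (beta w)) = Some (val (alpha s)).
Proof.
move=> F_lattice xys.
have [c xc] : ole (val (beta x)) (val (alpha s)).
  by apply/(beta_below iso); exists (val y).
suff /meager_type_of[w wc] : meager F c.
  by exists (beta' w); rewrite (betaK' iso) -wc.
move=> v vS vc.
have [q vq] := vc; rewrite -[oplus v q]/(Some v ⊕ Some q) in vq.
have e : Some v ⊕ (Some (val (beta x)) ⊕ Some q) = Some (val (alpha s)).
  by rewrite osumA [Some v ⊕ _]osumC -osumA vq.
have [t xqt] := osum_defr e; rewrite xqt in e.
have tS : sharp F t := sharp_diff F_lattice vS (sharp_type_val (alpha s)) e.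
have [t' et] := sharp_type_of tS; have [v' ev] := sharp_type_of vS.
rewrite et ev in e xqt *.
rewrite -[t'](alphaK' iso) -[v'](alphaK' iso) in e xqt *.
move/(alpha_sum iso): e => e; apply: (alpha0 iso).
have xt : ole (val x) (val (alpha' t')).
  by apply/(beta_below iso); apply: ole_osum xqt.
apply: (meager_type_val y) (sharp_type_val _) _.
have [r vx rs] := ole_add xt e; rewrite osumC in vx.
exact: ole_cancel vx xys rs.
Qed.

End TransportAtoms.

Record sd_atomic_arch_lattice (E : effectAlgebra) : Prop :=
    SdAtomicArchLattice {
  is_lattice : lattice_ordered E;
  is_arch : archimedean E;
  is_atomic : atomic E;
  is_sdom : sharply_dominating E
}.

Lemma has_ord_beta E F (alpha : sharp_type E -> sharp_type F) alpha'
    (beta : meager_type E -> meager_type F) beta'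
    (iso : triple_iso alpha alpha' beta beta')
    (E_lattice : lattice_ordered E) (F_lattice : lattice_ordered F)
    (F_arch : archimedean F) (a : meager_type E) n :
  atom (val a) -> has_ord (val a) n -> has_ord (val (beta a)) n.
Proof.
move=> aA an; have bA := beta_atom iso aA; have [j bj] := F_arch _ (proj1 bA).
suff -> : n = j by [].
apply/eqP; rewrite eqn_leq (ord_le_beta iso E_lattice F_lattice aA an bj) /=.
apply: (ord_le_beta (triple_iso_sym iso) F_lattice E_lattice bA bj).
by rewrite (betaK iso).
Qed.

(** For an atom [a] below [w] with multiplicity [k], passing to the complement in
    [F], transporting to [E] and passing to the complement there turns [k] into
    [n - k], and then back into [k] as its multiplicity in [y].  The last step
    needs [a] below [x], that is [k < n], which holds since [w] is meager. *)
Lemma sharp_complement_le E F (alpha : sharp_type E -> sharp_type F) alpha'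
    (beta : meager_type E -> meager_type F) beta'
    (iso : triple_iso alpha alpha' beta beta')
    (EP : sd_atomic_arch_lattice E) (FP : sd_atomic_arch_lattice F)
    (x y w : meager_type E) (s : sharp_type E) :
  oplus (val x) (val y) = Some (val s) ->
  oplus (val (beta x)) (val (beta w)) = Some (val (alpha s)) ->
  ole (val w) (val y).
Proof.
move=> xy bxw; apply: (ole_mult (is_lattice EP) (is_atomic EP) (is_arch EP)).
move=> a0 k u aA aw wk ku.
have [a ea] := meager_type_of (meager_le (meager_type_val w) aw).
rewrite {a0}ea in aA aw wk ku.
have [n an] := is_arch EP (proj1 aA).
have bn := has_ord_beta iso (is_lattice EP) (is_lattice FP) (is_arch FP) aA an.
have kn := mult_lt (is_lattice EP) (meager_type_val w) aA an wk.
have bwx : Some (val (beta w)) ⊕ Some (val (beta x)) = Some (val (alpha s)).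
  by rewrite osumC.
have xk : has_mult (val a) (val x) (n - k).
  rewrite -(betaK iso a) -(betaK iso x).
  apply: (beta_mult (triple_iso_sym iso)).
  apply: (mult_complement (is_lattice FP) bwx (sharp_type_val _)
            (beta_atom iso aA) bn).
    exact: (beta_le iso).
  exact: (beta_mult iso).
have ax : ole (val a) (val x).
  have [[v nv vx] _] := xk; apply: ole_trans vx.
  by apply: ole_nsum nv; rewrite subn_gt0.
have [[v kv vy] _] :=
  mult_complement (is_lattice EP) xy (sharp_type_val s) aA an ax xk.
by move: kv; rewrite subKn ?ku 1?ltnW // => -[->].
Qed.

(** The complement of [beta x] in [alpha s] is some [beta w]; comparing it with
    [y] in both directions, the second time along the inverse isomorphism of
    triples, gives [w = y]. *)
Lemma sharp_sum_transport E F (alpha : sharp_type E -> sharp_type F) alpha'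
    (beta : meager_type E -> meager_type F) beta'
    (iso : triple_iso alpha alpha' beta beta')
    (EP : sd_atomic_arch_lattice E) (FP : sd_atomic_arch_lattice F)
    (x y : meager_type E) (s : sharp_type E) :
  oplus (val x) (val y) = Some (val s) ->
  oplus (val (beta x)) (val (beta y)) = Some (val (alpha s)).
Proof.
move=> xy; have [w bxw] := meager_sum_transport iso (is_lattice FP) xy.
have wy := sharp_complement_le iso EP FP xy bxw.
suff yw : ole (val y) (val w).
  by have -> : y = w by apply: val_inj; apply: ole_anti.
have h := sharp_complement_le (triple_iso_sym iso) FP EP bxw
            (w := beta y) (s := alpha s).
rewrite (betaK iso x) (betaK iso y) (alphaK iso) in h.
by have := beta_le (triple_iso_sym iso) (h xy); rewrite !(betaK iso).
Qed.

(** * The isomorphism *)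

Definition triple_graph E F (alpha : sharp_type E -> sharp_type F)
    (beta : meager_type E -> meager_type F) (x : E) (z : F) : Prop :=
  exists s m, oplus (val s) (val m) = Some x /\
              oplus (val (alpha s)) (val (beta m)) = Some z.

Section Graph.
Variables (E F : effectAlgebra).
Variables (alpha : sharp_type E -> sharp_type F)
          (alpha' : sharp_type F -> sharp_type E)
          (beta : meager_type E -> meager_type F)
          (beta' : meager_type F -> meager_type E).
Hypothesis iso : triple_iso alpha alpha' beta beta'.
Hypotheses (EP : sd_atomic_arch_lattice E) (FP : sd_atomic_arch_lattice F).

Lemma triple_graph_sym x z :
  triple_graph alpha beta x z -> triple_graph alpha' beta' z x.
Proof.
move=> [s [m [sm asbm]]]; exists (alpha s), (beta m).
by rewrite (alphaK iso) (betaK iso).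
Qed.

Lemma sharp_meager_decomposition x :
  exists (s : sharp_type E) (m : meager_type E), oplus (val s) (val m) = Some x.
Proof.
have [s [m [sS mM smx _]]] :=
  greatest_sharp_below (is_lattice EP) (is_sdom EP) x.
by exists (SigSub (mem_set sS)), (SigSub (mem_set mM)).
Qed.

Lemma triple_graph_total x : exists z, triple_graph alpha beta x z.
Proof.
have [s [m smx]] := sharp_meager_decomposition x.
have [|z sz] := @beta_orth _ _ _ _ _ _ iso s m; first by exists x.
by exists z, s, m.
Qed.

Lemma triple_graph_functional x z z' :
  triple_graph alpha beta x z -> triple_graph alpha beta x z' -> z = z'.
Proof.
move=> [s [m [smx smz]]] [t [n [tnx tnz']]].
apply: Some_inj; rewrite -tnz' -smz.
have [/val_inj -> /val_inj -> //] :=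
  sharp_meager_uniq (is_lattice EP) (is_sdom EP)
    (sharp_type_val s) (meager_type_val m)
    (sharp_type_val t) (meager_type_val n) smx tnx.
Qed.

(** The summands [m] and [n] are meager; their sum is split into a sharp part
    [s0], which joins [s ⊕ t], and a meager part [m0]. *)
Lemma triple_graph_sum x y z x' y' :
  triple_graph alpha beta x x' -> triple_graph alpha beta y y' ->
  oplus x y = Some z ->
  exists2 z', triple_graph alpha beta z z' & oplus x' y' = Some z'.
Proof.
move=> [s [m [+ +]]] [t [n [+ +]]]; rewrite !oplusE => smx smx' tny tny' xyz.
have stmn :
    Some (val s) ⊕ Some (val t) ⊕ (Some (val m) ⊕ Some (val n)) = Some z.
  by rewrite osumACA smx tny.
have [p mnp] := osum_defr stmn; have [r str] := osum_defl stmn.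
have [s0 [m0 smp]] := sharp_meager_decomposition p.
have [m1 [m2 [n1 [n2 [m12 n12 mn1 mn2]]]]] := split_sum (is_lattice EP) mnp
  (sharp_type_val s0) (meager_type_val m0) smp.
have [m1' e1] := meager_type_of (meager_le (meager_type_val m) (ole_osum m12)).
have [m2' e2] := meager_type_of (meager_le (meager_type_val m) (ole_osumr m12)).
have [n1' e3] := meager_type_of (meager_le (meager_type_val n) (ole_osum n12)).
have [n2' e4] := meager_type_of (meager_le (meager_type_val n) (ole_osumr n12)).
rewrite {m1}e1 {m2}e2 {n1}e3 {n2}e4 in m12 n12 mn1 mn2.
have rS := sharp_sum (is_lattice EP) (sharp_type_val s) (sharp_type_val t) str.
have [r' er] := sharp_type_of rS; rewrite {r rS}er in str.
rewrite oplusE in smp; rewrite str mnp -smp osumA in stmn.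
have [q rsq] := osum_defl stmn.
have qS :=
  sharp_sum (is_lattice EP) (sharp_type_val r') (sharp_type_val s0) rsq.
have [q' qE] := sharp_type_of qS; rewrite {q qS}qE in rsq.
rewrite rsq in stmn.
have [|z' qmz'] := @beta_orth _ _ _ _ _ _ iso q' m0; first by exists z.
exists z'; first by exists q', m0.
have {mn1} := sharp_sum_transport iso EP FP mn1.
move/(beta_sum iso): mn2; move/(beta_sum iso): m12; move/(beta_sum iso): n12.
move/(alpha_sum iso): str; move/(alpha_sum iso): rsq.
rewrite !oplusE -smx' -tny' -qmz' => <- <- <- <- mn2 mn1.
by rewrite osumACA -[RHS]osumA -mn1 -mn2; congr (_ ⊕ _); apply: osumACA.
Qed.

End Graph.

Lemma triple_iso_of E F (alpha : sharp_type E -> sharp_type F)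
    (beta : meager_type E -> meager_type F) :
  effect_iso alpha -> gen_effect_iso beta ->
  (forall s, beta @` (hmap s) = hmap (alpha s)) ->
  exists alpha' beta', triple_iso alpha alpha' beta beta'.
Proof.
move=> [[[alpha' aK aK'] _ aD] a1] [[beta' bK bK'] _ bD] h.
exists alpha', beta'; split=> // [s t u|m n k|m s].
- rewrite -!sub_oplusP.
  have -> : sub_oplus (alpha s) (alpha t) = omap alpha (sub_oplus s t).
    exact: aD.
  by split=> [->//|]; case: (sub_oplus s t) => //= v [/(can_inj aK) ->].
- rewrite -!sub_oplusP.
  have -> : sub_oplus (beta m) (beta n) = omap beta (sub_oplus m n).
    exact: bD.
  by split=> [->//|]; case: (sub_oplus m n) => //= v [/(can_inj bK) ->].
- split=> [ms|].
    suff : hmap (alpha s) (beta m) by [].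
    by rewrite -h; exists m.
  move=> ms; have : hmap (alpha s) (beta m) by [].
  by rewrite -h => -[m' m's /(can_inj bK) <-].
Qed.

Theorem mainTheorem4 (E F : effectAlgebra)
    (E_lattice : lattice_ordered E) (E_arch : archimedean E)
    (E_atomic : atomic E) (E_sdom : sharply_dominating E)
    (F_lattice : lattice_ordered F) (F_arch : archimedean F)
    (F_atomic : atomic F) (F_sdom : sharply_dominating F)
    (alpha : sharp_type E -> sharp_type F)
    (beta : meager_type E -> meager_type F)
    (alpha_iso : effect_iso alpha) (beta_iso : gen_effect_iso beta)
    (h_compat : forall s : sharp_type E,
       beta @` (hmap s) = hmap (alpha s)) :
  exists f : E -> F, effect_iso f.
Proof.
have [alpha' [beta' iso]] := triple_iso_of alpha_iso beta_iso h_compat.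
have EP := SdAtomicArchLattice E_lattice E_arch E_atomic E_sdom.
have FP := SdAtomicArchLattice F_lattice F_arch F_atomic F_sdom.
have iso' := triple_iso_sym iso.
have [f fP] := choice (triple_graph_total iso EP).
have [g gP] := choice (triple_graph_total iso' FP).
have fE x z : triple_graph alpha beta x z -> f x = z.
  exact (triple_graph_functional EP (fP x)).
have gE z x : triple_graph alpha' beta' z x -> g z = x.
  exact (triple_graph_functional FP (gP z)).
have fK : cancel f g by move=> x; apply/gE/(triple_graph_sym iso).
have gK : cancel g f by move=> z; apply/fE/(triple_graph_sym iso').
have a0 : val (alpha ozero) = ozero by apply: (alpha0 iso).
have b0 : val (beta ozero) = ozero by apply: (beta0 iso).
exists f; split; [split|].
- by exists g.
- apply: fE; exists (ozero : sharp_type E), (ozero : meager_type E).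
  by rewrite a0 b0 !oplus0.
- move=> x y; case xy: (oplus x y) => [z|] /=.
    have [z' /fE <-] := triple_graph_sum iso EP FP (fP x) (fP y) xy.
    by [].
  case fxy: (oplus (f x) (f y)) => [z|] //.
  have [x'] := triple_graph_sum iso' FP EP (gP _) (gP _) fxy.
  by rewrite !fK xy.
- apply: fE; exists (oone : sharp_type E), (ozero : meager_type E).
  by rewrite (alpha1 iso) b0 !oplus0.
Qed.
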